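(* Any strongly uniformly totally bounded class $\widehat{\mathcal{X}}_{sut}$ of compact non-Archimedean metric spaces is pre-compact in the strong Gromov-Hausdorff topology. That is, any sequence of elements of $\widehat{\mathcal{X}}_{sut}$ contains a Cauchy subsequence under the metric $\widehat{d}_{GH}$.
   Context: A non-Archimedean metric space $(X,\widehat{d}_X)$ is a set with a metric satisfying the strong triangle inequality $\widehat{d}_X(x,z)\le\max\{\widehat{d}_X(x,y),\widehat{d}_X(y,z)\}$. The non-Archimedean Gromov-Hausdorff distance is $\widehat{d}_{GH}(X,Y)=\inf\{\widehat{d}_{H}(f(X),g(Y))\}$, the infimum being over all non-Archimedean metric spaces $(Z,\widehat{d}_Z)$ and all isometric embeddings $f:X\hookrightarrow Z$, $g:Y\hookrightarrow Z$, where $\widehat{d}_H$ is the Hausdorff distance between subsets of $Z$. The strong Gromov-Hausdorff topology is the one given by $\widehat{d}_{GH}$. A subset $S$ of a metric space $(X,d)$ is an $\varepsilon$-net if $\operatorname{dist}(x,S)=\inf_{s\in S}d(x,s)<\varepsilon$ for all $x\in X$. For a non-empty subset $S$ of a metric space $(X,d_X)$, put $W_X(S)=\{d_X(x,y):x,y\in S,\ x\ne y\}$. A class $\widehat{\mathcal{X}}_{sut}$ of compact non-Archimedean metric spaces is strongly uniformly totally bounded if for every $\varepsilon>0$ there exist a positive integer $N=N(\varepsilon)$ and a finite set $R(\varepsilon)\subset\mathbb{R}_{>0}$ of positive real numbers such that every $X\in\widehat{\mathcal{X}}_{sut}$ contains an $\varepsilon$-net $S_{(X)}$ consisting of no more than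 $N$ points and with $W_X(S_{(X)})\subset R(\varepsilon)$. *)

(* Defs.v *)
From mathcomp Require Import all_boot all_order all_algebra.
From mathcomp Require Import all_classical all_reals all_analysis.

Set Implicit Arguments.
Unset Strict Implicit.
Unset Printing Implicit Defensive.

Import Order.TTheory GRing.Theory Num.Theory.

Local Open Scope classical_set_scope.
Local Open Scope ring_scope.

Section NonArchimedeanMetric.
Context {R : realType}.

Definition non_archimedean (X : metricType R) : Prop :=
  forall x y z : X, mdist x z <= Num.max (mdist x y) (mdist y z).

Definition isometric_embedding (X Z : metricType R) (f : X -> Z) : Prop :=
  forall x y : X, mdist (f x) (f y) = mdist x y.

(* Extended-real valued, so that the distance to the empty set is +oo. *)
Definition dist_to_set (X : metricType R) (x : X) (S : set X) : \bar R :=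
  ereal_inf [set (mdist x s)%:E | s in S].

Definition set_neighborhood (X : metricType R) (r : R) (S : set X) : set X :=
  [set x | (dist_to_set x S < r%:E)%E].

(* It is +oo exactly when no r > 0 is admissible, for instance when only one
   of the two sets is empty. *)
Definition hausdorff_distance (Z : metricType R) (A B : set Z) : \bar R :=
  ereal_inf [set r%:E | r in [set r : R |
    [/\ 0 < r, A `<=` set_neighborhood r B & B `<=` set_neighborhood r A]]].

Definition na_gromov_hausdorff (X Y : metricType R) : \bar R :=
  ereal_inf [set e : \bar R |
    exists (Z : metricType R) (f : X -> Z) (g : Y -> Z),
      [/\ non_archimedean Z, isometric_embedding f, isometric_embedding g
        & e = hausdorff_distance (range f) (range g)]].

Definition epsilon_net (X : metricType R) (eps : R) (S : set X) : Prop :=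
  forall x : X, (dist_to_set x S < eps%:E)%E.

Definition distance_values (X : metricType R) (S : set X) : set R :=
  [set r | exists x y : X, [/\ S x, S y, x <> y & r = mdist x y]].

Definition compact_na_class (C : metricType R -> Prop) : Prop :=
  forall X : metricType R, C X -> compact [set: X] /\ non_archimedean X.

Definition strongly_uniformly_totally_bounded (C : metricType R -> Prop) :
    Prop :=
  forall eps : R, 0 < eps ->
    exists (N : nat) (Q : set R),
      [/\ (0 < N)%N, finite_set Q, Q `<=` [set r | 0 < r]
        & forall X : metricType R, C X ->
            exists S : set X,
              [/\ epsilon_net eps S, (S #<= `I_N)%card & distance_values S `<=` Q]].

Definition na_gh_cauchy (X : nat -> metricType R) : Prop :=
  forall eps : R, 0 < eps ->
    exists N : nat, forall m n : nat, (N <= m)%N -> (N <= n)%N ->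
      (na_gromov_hausdorff (X m) (X n) < eps%:E)%E.

Definition na_gh_precompact (C : metricType R -> Prop) : Prop :=
  forall X : nat -> metricType R, (forall n, C (X n)) ->
    exists phi : nat -> nat,
      {homo phi : m n / (m < n)%N} /\ na_gh_cauchy (fun n => X (phi n)).

End NonArchimedeanMetric.

(* Main.v *)
(* Since the nets have at most N points and distances in a finite set, at each
   scale eps only finitely many distance matrices of eps-nets occur. Two spaces
   with equal matrices can be glued along their nets into one non-Archimedean
   space in which they are eps-close. So at every scale the sequence is finitely
   coloured, with equal colours implying eps-closeness, and a diagonal sequence
   that is eventually monochromatic for every scale 1/(j+1) is Cauchy. *)
From HB Require Import structures.
Require Import Defs.
From mathcomp Require Import all_boot all_order all_algebra.
From mathcomp Require Import all_classical all_reals all_analysis.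

Set Implicit Arguments.
Unset Strict Implicit.
Unset Printing Implicit Defensive.

Import Order.TTheory GRing.Theory Num.Theory.

Local Open Scope classical_set_scope.
Local Open Scope ring_scope.

(** Infinite pigeonhole principle: if each colour [t] stopped occurring in [A] from some bound [b t]
    on, an element of [A] beyond the largest bound would have no colour. *)
Lemma infinitely_often_fiber (T : finType) (c : nat -> T) (A : set nat) :
  (forall N, exists2 n, (N <= n)%N & A n) ->
  exists t, forall N, exists2 n, (N <= n)%N & (A `&` c @^-1` [set t]) n.
Proof.
move=> Ainf; apply: contrapT => /forallNP noT.
have /choice[b bP] (t : T) :
    exists N, forall n, (N <= n)%N -> A n -> c n <> t.
  have /existsNP[N NP] := noT t.
  by exists N => n Nn An cn; apply: NP; exists n.
have [n bn An] := Ainf (\max_t b t)%N.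
exact: bP (c n) n (leq_trans (leq_bigmax (c n)) bn) An erefl.
Qed.

Lemma diagonal_monochromatic (T : nat -> finType) (c : forall j, nat -> T j) :
  exists phi : nat -> nat, {homo phi : m n / (m < n)%N} /\
    forall j m n, (j <= m)%N -> (j <= n)%N -> c j (phi m) = c j (phi n).
Proof.
pose inf_set := {A : set nat | forall N, exists2 n, (N <= n)%N & A n}.
have /choice[next nextP] (jA : nat * inf_set) : exists B : inf_set,
    sval B `<=` sval jA.2 /\
    exists t, forall n, sval B n -> c jA.1 n = t.
  case: jA => j [A Ainf] /=; have [t tP] := infinitely_often_fiber (c j) Ainf.
  exists (exist _ _ tP); split => [n []//|]; by exists t => n [].
have allP N : exists2 n, (N <= n)%N & [set: nat] n by exists N.
pose A := fix A j : inf_set :=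
  if j is j'.+1 then next (j', A j') else exist _ setT allP.
have A_anti i j : (i <= j)%N -> sval (A j) `<=` sval (A i).
  elim: j => [|j IH]; first by rewrite leqn0 => /eqP ->.
  rewrite leq_eqVlt => /predU1P[->//|/IH Aji].
  by apply: subset_trans Aji; have [] := nextP (j, A j).
have /choice[pick_above pickP] (jN : nat * nat) :
    exists n, (jN.2 <= n)%N /\ sval (A jN.1) n.
  by have [n ? ?] := svalP (A jN.1) jN.2; exists n.
(* The index is shifted by one: [phi j] is taken in [A j.+1], the first of the nested sets on which
   [c j] is constant. *)
pose phi := fix phi j := if j is j'.+1 then pick_above (j.+1, (phi j').+1)
                         else pick_above (1%N, 0%N).
have phiA j : sval (A j.+1) (phi j).
  case: j => [|j]; first by have [] := pickP (1%N, 0%N).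
  by have [] := pickP (j.+2, (phi j).+1).
exists phi; split.
  by apply: (homo_ltn ltn_trans) => j; have [] := pickP (j.+2, (phi j).+1).
move=> j m n jm jn; have [_ [t tP]] := nextP (j, A j).
rewrite !tP //.
- exact: (A_anti j.+1 n.+1).
- exact: (A_anti j.+1 m.+1).
Qed.

Section Gluing.
Context {R : realType}.

(* HB.pack needs a type whose choiceType instance is canonical, which a variable
   U : choiceType is not; hence the copy. *)
Definition choice_carrier (U : choiceType) : Type := U.
HB.instance Definition _ (U : choiceType) := Choice.on (choice_carrier U).

Lemma na_metric_space (U : choiceType) (d : U -> U -> R) :
  (forall u, d u u = 0) -> (forall u v, d u v = 0 -> u = v) ->
  (forall u v, 0 <= d u v) ->
  (forall u v, d u v = d v u) ->
  (forall u v w, d u w <= Num.max (d u v) (d v w)) ->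
  exists (Z : metricType R) (h : U -> Z),
    non_archimedean Z /\ forall u v, mdist (h u) (h v) = d u v.
Proof.
move=> d0 dpos dge0 dsym dmax.
have dtri v u w : d u w <= d u v + d v w.
  by rewrite (le_trans (dmax u v w))// ge_max lerDl lerDr !dge0.
pose M := isMetric.Build R (choice_carrier U) d0 dpos dsym dtri.
pose Z : metricType R := HB.pack (choice_carrier U) M.
by exists Z, id.
Qed.

Lemma dist_to_set_le (X : metricType R) (x s : X) (S : set X) :
  S s -> (dist_to_set x S <= (mdist x s)%:E)%E.
Proof. by move=> Ss; apply: ereal_inf_lbound; exists s. Qed.

Lemma hausdorff_distance_le (Z : metricType R) (A B : set Z) (eps : R) :
  0 < eps ->
  (forall a, A a -> exists2 b, B b & mdist a b <= eps) ->
  (forall b, B b -> exists2 a, A a & mdist b a <= eps) ->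
  (hausdorff_distance A B <= eps%:E)%E.
Proof.
have near (S S' : set Z) e :
    (forall z, S z -> exists2 z', S' z' & mdist z z' <= eps) ->
    eps < e -> S `<=` set_neighborhood e S'.
  move=> SS' ltee z /SS'[z' S'z' zz']; rewrite /set_neighborhood/=.
  by rewrite (le_lt_trans (dist_to_set_le z S'z'))// lte_fin (le_lt_trans zz').
(* Neighbourhoods are open, so [eps] itself may fail to be admissible; every [eps + e] is. *)
move=> eps_gt0 AB BA; apply/lee_addgt0Pr => e e_gt0; apply: ereal_inf_lbound.
have lte : eps < eps + e by rewrite ltrDl.
exists (eps + e) => //; split; first exact: addr_gt0.
- exact: near lte.
- exact: near lte.
Qed.

(** The strong triangle inequality as transitivity of the relation [mdist x y <= r] at each fixed
    scale [r], the form used for gluing. *)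
Lemma na_trans (X : metricType R) (r : R) (y x z : X) : non_archimedean X ->
  mdist x y <= r -> mdist y z <= r -> mdist x z <= r.
Proof.
by move=> Xna xy yz; rewrite (le_trans (Xna x y z))// ge_max xy.
Qed.

(* Points x : X and y : Y are put at distance max(eps, mdist (s i) (s j)), where
   s i and t j are net points chosen within eps of x and y. At every scale
   r >= eps, the relation d u v <= r then only depends on the chosen net points;
   below eps, it never relates X to Y. *)
Lemma na_gromov_hausdorff_le (X Y : metricType R) (I : Type)
    (s : I -> X) (t : I -> Y) (eps : R) :
  non_archimedean X -> non_archimedean Y -> 0 < eps ->
  (forall i j, mdist (s i) (s j) = mdist (t i) (t j)) ->
  (forall x, exists i, mdist x (s i) < eps) ->
  (forall y, exists i, mdist y (t i) < eps) ->
  (na_gromov_hausdorff X Y <= eps%:E)%E.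
Proof.
move=> Xna Yna eps_gt0 st /choice[p pP] /choice[q qP].
pose D i j := mdist (s i) (s j).
pose d (u v : X + Y) : R := match u, v with
  | inl x, inl x' => mdist x x'
  | inr y, inr y' => mdist y y'
  | inl x, inr y => Num.max eps (D (p x) (q y))
  | inr y, inl x => Num.max eps (D (q y) (p x))
  end.
pose rho (u : X + Y) := match u with inl x => p x | inr y => q y end.
have dE r u v : eps <= r -> (d u v <= r) = (D (rho u) (rho v) <= r).
  have samesideE (W : metricType R) (w w' a a' : W) : non_archimedean W ->
      mdist w a < eps -> mdist w' a' < eps -> eps <= r ->
      (mdist w w' <= r) = (mdist a a' <= r).
    move=> Wna wa wa' er.
    have {}wa : mdist w a <= r by rewrite (le_trans (ltW wa)).
    have {}wa' : mdist w' a' <= r by rewrite (le_trans (ltW wa')).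
    have aw : mdist a w <= r by rewrite metric_sym.
    have aw' : mdist a' w' <= r by rewrite metric_sym.
    apply/idP/idP => ww'.
    - exact: na_trans Wna aw (na_trans Wna ww' wa').
    - exact: na_trans Wna wa (na_trans Wna ww' aw').
  move=> er; case: u v => [x|y] [x'|y'] /=.
  - exact: samesideE.
  - by rewrite ge_max er.
  - by rewrite ge_max er.
  - by rewrite /D st; exact: samesideE.
have d0 u : d u u = 0 by case: u => z; exact: mdistxx.
have crossN0 x : Num.max eps x != 0 by rewrite gt_eqF// lt_max eps_gt0.
have dpos u v : d u v = 0 -> u = v.
  case: u v => [x|y] [x'|y'] /=; try by move/eqP; rewrite (negPf (crossN0 _)).
  - by move/mdist_positivity ->.
  - by move/mdist_positivity ->.
have dge0 u v : 0 <= d u v.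
  by case: u v => [x|y] [x'|y'] /=; rewrite ?mdist_ge0// le_max (ltW eps_gt0).
have dsym u v : d u v = d v u.
  by case: u v => [x|y] [x'|y'] /=; rewrite /D metric_sym.
(* For [r >= eps], transitivity is pulled back from the net points in [X]; for [r < eps], only
   triples lying on one side remain. *)
have dtrans r u v w : d u v <= r -> d v w <= r -> d u w <= r.
  have [er|re] := leP eps r; first by rewrite !dE//; exact: na_trans.
  have crossF a : (Num.max eps a <= r) = false.
    by apply/negbTE; rewrite -ltNge lt_max re.
  case: u v w => [x|y] [x'|y'] [x''|y''] /=; rewrite ?crossF//; exact: na_trans.
have dmax u v w : d u w <= Num.max (d u v) (d v w).
  by apply: (dtrans _ u v w); rewrite le_max lexx ?orbT.
have [Z [h [Zna hd]]] := na_metric_space d0 dpos dge0 dsym dmax.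
apply: (@le_trans _ _
    (hausdorff_distance (range (h \o inl)) (range (h \o inr)))).
  apply: ereal_inf_lbound; exists Z, (h \o inl), (h \o inr).
  by split=> // z z'; rewrite /= hd.
apply: hausdorff_distance_le => // _ [z _ <-].
(* The net point chosen for [t (p z)] may have an index other than [p z], but it lies within [eps]
   of [t (p z)]; [st] carries this bound over to [X]. *)
- exists (h (inr (t (p z)))); first by exists (t (p z)).
  by rewrite /= hd dE//= /D st ltW.
- exists (h (inl (s (q z)))); first by exists (s (q z)).
  by rewrite /= hd dE//= /D ltW.
Qed.

(** Index type and distance matrix depend on the code [k] alone, so spaces with the same code have
    nets that match point by point, as gluing requires. *)
Lemma finitely_many_nets (C : metricType R -> Prop) (eps : R) :
  strongly_uniformly_totally_bounded C -> 0 < eps ->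
  exists (T : finType) (I : T -> Type) (D : forall k, I k -> I k -> R),
    forall X, C X -> exists (k : T) (s : I k -> X),
      (forall i j, mdist (s i) (s j) = D k i j) /\
      forall x, exists i, mdist x (s i) < eps.
Proof.
move=> Csutb eps_gt0.
have [N [Q [_ /finite_seqP[q ->] _ nets]]] := Csutb eps eps_gt0.
(* The entry 0 serves the diagonal and repeated points; [None], with no indices, encodes the empty
   space. *)
pose T : finType := option {ffun 'I_N * 'I_N -> seq_sub (0 :: q)}.
pose I (k : T) : Type := if k is Some _ then 'I_N else void.
exists T, I, (fun k => match k return I k -> I k -> R with
                  | Some D => fun i j => ssval (D (i, j))
                  | None => fun _ _ => 0
                  end).
move=> X CX; have [S [S_net S_card S_dist]] := nets X CX.
have net x : exists2 y, S y & mdist x y < eps.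
  by have /ereal_inf_lt[_ [y Sy <-]] := S_net x; rewrite lte_fin; exists y.
have [[x0]|noX] := pselect (exists x : X, True); last first.
  exists None, (fun v : void => match v with end); split=> [[]//|x].
  by case: noX; exists x.
have [y0 Sy0 _] := net x0.
have [g gS] : exists g : nat -> X, S `<=` g @` `I_N.
  have /ocard_geP[g] := S_card; exists (fun n => odflt y0 (g n)) => y Sy.
  have [n nN gn] := 'surj_g (imageP Some Sy).
  by exists n; rewrite ?gn.
(* [g] covers [S] but may also take values outside it; those are replaced by [y0], so that all
   distances stay in [0 :: q]. *)
pose s (i : 'I_N) : X := if `[< S (g i) >] then g i else y0.
have Ss i : S (s i) by rewrite /s; case: asboolP.
have sq i j : mdist (s i) (s j) \in 0 :: q.
  have [->|/eqP ij] := eqVneq (s i) (s j); first by rewrite mdistxx mem_head.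
  by rewrite inE; apply/orP; right; apply: S_dist; exists (s i), (s j).
exists (Some [ffun ij => SeqSub (sq ij.1 ij.2)]), s; split=> [i j|x].
  by rewrite ffunE.
have [y Sy xy] := net x; have [n /= nN gy] := gS y Sy.
exists (Ordinal nN); by rewrite /s /= gy; case: asboolP.
Qed.

Lemma finite_coloring (C : metricType R -> Prop) (X : nat -> metricType R)
    (eps : R) :
  compact_na_class C -> strongly_uniformly_totally_bounded C ->
  (forall n, C (X n)) -> 0 < eps ->
  exists (T : finType) (c : nat -> T), forall m n, c m = c n ->
    (na_gromov_hausdorff (X m) (X n) <= eps%:E)%E.
Proof.
move=> Cna Csutb CX eps_gt0.
have [T [I [D netD]]] := finitely_many_nets Csutb eps_gt0.
have /choice[c cP] := fun n => netD (X n) (CX n).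
exists T, c => m n cmn; have [t [tD t_net]] := cP n.
have := cP m; rewrite cmn => -[s [sD s_net]].
have na i : non_archimedean (X i) by have [] := Cna _ (CX i).
by apply: (@na_gromov_hausdorff_le _ _ _ s t) => // i j; rewrite sD tD.
Qed.

End Gluing.

Theorem theoremD (R : realType) (C : metricType R -> Prop)
    (C_compact_na : compact_na_class C)
    (C_sutb : strongly_uniformly_totally_bounded C) :
  na_gh_precompact C.
Proof.
move=> X CX.
pose eps j : R := j.+1%:R^-1.
(* The set of colours varies with the scale, so it is chosen together with the colouring. *)
have /choice[c cP] (j : nat) : exists c : {T : finType & nat -> T},
    forall m n, projT2 c m = projT2 c n ->
      (na_gromov_hausdorff (X m) (X n) <= (eps j)%:E)%E.
  have eps_gt0 : 0 < eps j by rewrite invr_gt0.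
  have [T [c cP]] := finite_coloring C_compact_na C_sutb CX eps_gt0.
  by exists (existT (fun T : finType => nat -> T) T c).
have [phi [phi_incr phiP]] := diagonal_monochromatic (fun j => projT2 (c j)).
exists phi; split=> // e e_gt0; pose N := Num.truncn e^-1.
(* Equal colours give only a non-strict bound, so the strict Cauchy inequality comes from here. *)
have N_lt : eps N < e by rewrite invf_plt ?posrE// truncnS_gt.
exists N => m n Nm Nn; apply: (@le_lt_trans _ _ (eps N)%:E).
- exact: cP (phiP N m n Nm Nn).
- by rewrite lte_fin.
Qed.
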